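(* Let $(X,\mathcal{A},\mu)$ be a measure space and let $I$ be an ideal (not necessarily proper) in $\mathcal{M}(X,\mathcal{A})$. Equip $\mathcal{M}(X,\mathcal{A})$ with the $U_\mu^I$-topology and, for $f\in\mathcal{M}(X,\mathcal{A})$, let $\phi_f:\mathbb{R}\to\mathcal{M}(X,\mathcal{A})$, $\phi_f(r)=r\cdot f$, where $\mathbb{R}$ has its usual topology. Then: (1) For each $f\in\mathcal{M}(X,\mathcal{A})$, the map $\phi_f$ is continuous if and only if $f\in I\cap L^\infty(X,\mathcal{A},\mu)$. (2) $I\cap L^\infty(X,\mathcal{A},\mu)$ is the connected component of $0$ in $\mathcal{M}(X,\mathcal{A})$ with the $U_\mu^I$-topology.
   Context: $X$ is a non-empty set, $\mathcal{A}$ a $\sigma$-algebra on $X$, $\mu:\mathcal{A}\to[0,\infty]$ a measure. $\mathcal{M}(X,\mathcal{A})$ is the commutative ring of all measurable functions $X\to\mathbb{R}$ under pointwise operations. A $\mu$-null set is a set $E\in\mathcal{A}$ with $\mu(E)=0$. For an ideal $I$ of $\mathcal{M}(X,\mathcal{A})$, $f\in\mathcal{M}(X,\mathcal{A})$ and real $\epsilon>0$, put $U_\mu(f,I,\epsilon)=\{g\in\mathcal{M}(X,\mathcal{A}): g-f\in I$ and $\sup_{x\in X\setminus E}|f(x)-g(x)|<\epsilon$ for some $\mu$-null set $E\}$ (supremum taken in $[0,\infty]$). These sets form an open base of the $U_\mu^I$-topology on $\mathcal{M}(X,\mathcal{A})$. $L^\infty(X,\mathcal{A},\mu)$ denotes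 the set of all essentially bounded $f\in\mathcal{M}(X,\mathcal{A})$, i.e. those for which there is a $\mu$-null set $E$ such that $f$ is bounded on $X\setminus E$ (functions are not identified when equal almost everywhere). *)

(* Defs.v *)
From HB Require Import structures.
From mathcomp Require Import all_boot all_order all_algebra.
From mathcomp Require Import all_classical all_reals all_analysis measurable_realfun.
From mathcomp Require Import lra.

Set Implicit Arguments.
Unset Strict Implicit.
Unset Printing Implicit Defensive.

Import Order.TTheory GRing.Theory Num.Theory.
Import numFieldNormedType.Exports.

Local Open Scope classical_set_scope.
Local Open Scope ring_scope.

(* The library's [idealr_closed] forces ideals to be proper; here the whole
   ring is allowed. Closure under opposites follows from [ideal_mull]. *)
Record ideal (A : comNzRingType) := Ideal {
  ideal_set :> set A;
  ideal0 : ideal_set 0;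
  idealD : forall x y, ideal_set x -> ideal_set y -> ideal_set (x + y);
  ideal_mull : forall a x, ideal_set x -> ideal_set (a * x) }.

Section Umu.
Context {d : measure_display} {X : measurableType d} {R : realType}.
Variable mu : {measure set X -> \bar R}.
Implicit Types (f g h : {mfun X >-> R}) (I : ideal {mfun X >-> R}).

(* Members of L^oo are functions, not classes modulo a.e. equality. *)
Definition Linfty : set {mfun X >-> R} :=
  [set f | exists2 E : set X, measurable E /\ mu E = 0%E &
    [bounded f x | x in ~` E]].

(* [ereal_sup set0] is -oo instead of 0, which is immaterial here: for
   [0 < eps] both are [< eps]. *)
Definition Umu f I (eps : R) : set {mfun X >-> R} :=
  [set g | ideal_set I (g - f) /\
    exists2 E : set X, measurable E /\ mu E = 0%E &
      (ereal_sup [set `|f x - g x|%:E | x in ~` E] < eps%:E)%E].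

Definition Umu_base I : set (set {mfun X >-> R}) :=
  [set U | exists f (eps : R), 0 < eps /\ U = Umu f I eps].

Lemma UmuP f I eps g : Umu f I eps g <-> ideal_set I (g - f) /\
  exists E : set X, exists r : R, [/\ measurable E, mu E = 0%E, r < eps &
    forall x, ~ E x -> `|f x - g x| <= r].
Proof.
split=> -[Igf].
  case=> E [mE E0] ltS; split=> //; exists E.
  have ub x : ~ E x ->
      (`|f x - g x|%:E <= ereal_sup [set `|f x - g x|%:E | x in ~` E])%E.
    by move=> Ex; apply: ereal_sup_ubound; exists x.
  case: (ereal_sup _) ltS ub => [r| |] // ltS ub.
    by exists r; split=> // x /ub; rewrite lee_fin.
  by exists (eps - 1); split=> // [|x /ub //]; lra.
move=> [E [r [mE E0 reps ub]]]; split=> //; exists E => //.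
apply: (@le_lt_trans _ _ r%:E); last by rewrite lte_fin.
by apply: ge_ereal_sup => _ [x Ex <-]; rewrite lee_fin; exact: ub.
Qed.

Lemma Umu_center f I eps : 0 < eps -> Umu f I eps f.
Proof.
move=> eps0; apply/UmuP; rewrite subrr; split; first exact: ideal0.
exists set0, 0; split=> // x _; by rewrite subrr normr0.
Qed.

Lemma Umu_ball f I eps g : Umu f I eps g ->
  exists2 del : R, 0 < del &
    forall del', del' <= del -> Umu g I del' `<=` Umu f I eps.
Proof.
move=> /UmuP[Igf [E [r [mE E0 reps ub]]]].
exists (eps - r); first by lra.
move=> del' ledel h /UmuP[Ihg [E' [r' [mE' E'0 rdel ub']]]]; apply/UmuP; split.
  by have := idealD Ihg Igf; rewrite addrA subrK.
exists (E `|` E'), (r + r'); split.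
- exact: measurableU.
- by rewrite measureU0.
- by lra.
- move=> x /not_orP[/ub + /ub']; have := ler_distD (g x) (f x) (h x).
  by lra.
Qed.

Lemma Umu_base_cover I : \bigcup_(U in Umu_base I) U = setT.
Proof.
apply/seteqP; split=> // f _; exists (Umu f I 1); last exact: Umu_center.
by exists f, 1.
Qed.

Lemma Umu_base_join I (U V : set {mfun X >-> R}) f :
  Umu_base I U -> Umu_base I V -> U f -> V f ->
  exists W, [/\ Umu_base I W, W f & W `<=` U `&` V].
Proof.
move=> [g [e [e0 ->]]] [h [e' [e'0 ->]]] /Umu_ball[a a0 ha] /Umu_ball[b b0 hb].
have m0 : 0 < Num.min a b by rewrite lt_min a0.
exists (Umu f I (Num.min a b)); split.
- by exists f, (Num.min a b).
- exact: Umu_center.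
- by rewrite subsetI; split; [apply: ha|apply: hb]; rewrite ge_min lexx ?orbT.
Qed.

End Umu.

(* The ring M(X, A) of measurable functions, carrying the U_mu^I-topology:
   the unused parameters [mu] and [I] select the topology. *)
Definition UmuI d (X : measurableType d) (R : realType)
  (mu : {measure set X -> \bar R}) (I : ideal {mfun X >-> R}) : Type :=
  {mfun X >-> R}.

Section UmuI_instances.
Context d (X : measurableType d) (R : realType).
Variables (mu : {measure set X -> \bar R}) (I : ideal {mfun X >-> R}).

HB.instance Definition _ :=
  GRing.ComNzRing.copy (UmuI mu I) {mfun X >-> R}.
HB.instance Definition _ :=
  GRing.Lmodule.copy (UmuI mu I) {mfun X >-> R}.
HB.instance Definition _ := isBaseTopological.Build (UmuI mu I)
  (Umu_base_cover mu I) (@Umu_base_join _ _ _ mu I).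

End UmuI_instances.

(* Main.v *)
(** For [f] in [I] with [`|f| <= M] off a null set, [r *: f - s *: f] lies in
    [I] and is bounded by [`|r - s| * M] off that set, so [r |-> r *: f] is
    continuous; conversely, continuity at [0] puts some [s *: f] with [s != 0]
    in [Umu 0 I 1].  The images of these continuous maps connect every point of
    the intersection of [I] and [L^oo] to [0]; this intersection is clopen since
    being in it is unchanged when passing from [f] to a point of [Umu f I 1]. *)
Require Import Defs.
From mathcomp Require Import all_boot all_order all_algebra.
From mathcomp Require Import all_classical all_reals all_analysis measurable_realfun.
From mathcomp Require Import lra.
Import Order.TTheory GRing.Theory Num.Theory.
Import numFieldNormedType.Exports.
Local Open Scope classical_set_scope.
Local Open Scope ring_scope.

Section Umu_topology.
Context {d : measure_display} {X : measurableType d} {R : realType}.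
Variable mu : {measure set X -> \bar R}.
Variable I : ideal {mfun X >-> R}.
Implicit Types f g : {mfun X >-> R}.

Lemma LinftyP f : Linfty mu f <->
  exists E : set X, exists M : R,
    [/\ measurable E, mu E = 0%E & forall x, ~ E x -> `|f x| <= M].
Proof.
split=> [[E [mE E0]] [M [_ fM]]|[E [M [mE E0 fM]]]].
  (* [[bounded _ | _ in _]] yields a threshold [M] such that every number strictly above [M] is a
     bound; [M] itself need not be one at this point. *)
  by exists E, (M + 1); split=> // x; apply: fM; rewrite ltrDl.
exists E => //; exists M; split=> [|N MN x /fM fxM]; first exact: num_real.
exact: le_trans fxM (ltW MN).
Qed.

Lemma scale_mfunE (r : R) f x : (r *: f) x = r * f x.
Proof. by []. Qed.

(** Constant functions are measurable, so scaling is multiplication by a ring element. *)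
Lemma ideal_scale (r : R) f : ideal_set I f -> ideal_set I (r *: f).
Proof.
have -> : r *: f = (cst r : {mfun X >-> R}) * f by apply/mfuneqP.
exact: ideal_mull.
Qed.

Lemma ideal_opp f : ideal_set I f -> ideal_set I (- f).
Proof. by move=> /(ideal_mull (-1)); rewrite mulN1r. Qed.

(** Basic open sets may be centred anywhere; [Umu_ball] recentres one containing [f] at [f]
    itself. *)
Lemma nbhs_UmuIP (f : UmuI mu I) (A : set (UmuI mu I)) :
  nbhs f A <-> exists2 eps : R, 0 < eps & Umu mu f I eps `<=` A.
Proof.
rewrite nbhsE; split=> [[B [oB Bf] BA]|[eps eps0 UA]].
  case: oB => D Dbase DB; move: Bf; rewrite -DB => -[U DU Uf].
  have [g [e [e0 Ue]]] := Dbase _ DU; rewrite Ue in Uf.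
  have [del del0 /(_ _ (lexx _)) sub] := Umu_ball Uf.
  exists del => // h /sub Uh; apply: BA; rewrite -DB; exists U => //.
  by rewrite Ue.
exists (Umu mu f I eps : set (UmuI mu I)) => //; split; last exact: Umu_center.
exists [set (Umu mu f I eps)]; last by rewrite bigcup_set1.
by move=> _ ->; exists f, eps.
Qed.

Lemma Umu_scale_continuousP (f : UmuI mu I) :
  continuous (fun r : R => r *: f) <-> (ideal_set I `&` Linfty mu) f.
Proof.
split=> [/(_ 0)|[If /LinftyP[E [M [mE E0 fM]]]] r].
  have : nbhs (0 *: f) (Umu mu (0 *: f) I 1 : set (UmuI mu I)).
    by apply/nbhs_UmuIP; exists 1.
  move=> /[swap] /[apply] /nbhs_ballP[e /= e0].
  (* Since [s] is invertible, [f] is recovered from [s *: f], both for membership in [I] and for the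
     essential bound. *)
  have [s s0 se] : exists2 s : R, 0 < s & s < e by exists (e / 2); lra.
  move=> /(_ s); rewrite /ball /= sub0r normrN gtr0_norm // => /(_ se).
  rewrite scale0r => /UmuP[].
  rewrite subr0 => If [E [r [mE E0 _ fr]]]; split.
    by rewrite -[f]scale1r -(mulVf (lt0r_neq0 s0)) -scalerA; exact: ideal_scale.
  apply/LinftyP; exists E, (`|s^-1| * r); split=> // x /fr.
  rewrite (_ : _ - _ = - (s *: f) x) ?normrN => [{}fr|]; last exact: sub0r.
  rewrite -[f x]mul1r -(mulVf (lt0r_neq0 s0)) -mulrA normrM.
  exact: ler_wpM2l.
move=> A /nbhs_UmuIP[eps eps0 UA].
(* [M] may vanish, or be negative if [E] is all of [X]; [|M| + 1] is a safe divisor. *)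
have M0 : 0 < `|M| + 1 by have := normr_ge0 M; lra.
apply/nbhs_ballP; exists (eps / 2 / (`|M| + 1)); first by rewrite /= !divr_gt0.
move=> s; rewrite /ball /= ltr_pdivlMr // => rs; apply: UA; apply/UmuP; split.
  by rewrite -scalerBl; exact: ideal_scale.
(* Half of [eps] leaves room for the strict inequality between the uniform bound and [eps]. *)
exists E, (eps / 2); split=> //; first lra.
move=> x /fM fxM; rewrite !scale_mfunE -mulrBl normrM.
apply: le_trans (ltW rs); apply: ler_wpM2l => //.
by have := ler_norm M; lra.
Qed.

(** The difference [g - f] lies in [I] and is essentially bounded, so adding or subtracting it
    preserves both conditions; the two exceptional null sets are united. *)
Lemma Umu_ideal_Linfty {f} {eps : R} {g} : Umu mu f I eps g ->
  (ideal_set I `&` Linfty mu) f <-> (ideal_set I `&` Linfty mu) g.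
Proof.
move=> /UmuP[Igf [E [r [mE E0 _ ub]]]]; split=> -[Ih] /LinftyP[E' [M [mE' E'0 hM]]].
  split; first by rewrite -(subrK f g); exact: idealD.
  apply/LinftyP; exists (E `|` E'), (r + M); split.
  - exact: measurableU.
  - by rewrite measureU0.
  - move=> x /not_orP[/ub + /hM]; have := ler_distD (f x) (g x) 0.
    by rewrite !subr0 distrC; lra.
split.
  by rewrite -[f](subKr g); apply: idealD => //; exact: ideal_opp.
apply/LinftyP; exists (E `|` E'), (r + M); split.
- exact: measurableU.
- by rewrite measureU0.
- move=> x /not_orP[/ub + /hM]; have := ler_distD (g x) (f x) 0.
  by rewrite !subr0; lra.
Qed.

Lemma clopen_ideal_Linfty :
  clopen (ideal_set I `&` Linfty mu : set (UmuI mu I)).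
Proof.
split.
  rewrite openE => f Jf; apply/nbhs_UmuIP; exists 1 => // g Ufg.
  by apply/(Umu_ideal_Linfty Ufg).
rewrite -openC openE => f Jf; apply/nbhs_UmuIP; exists 1 => // g Ufg Jg.
by apply/Jf/(Umu_ideal_Linfty Ufg).
Qed.

Lemma connected_component0_UmuI :
  connected_component [set: UmuI mu I] 0 = ideal_set I `&` Linfty mu.
Proof.
set J := _ `&` _.
have J0 : J 0.
  split; first exact: ideal0.
  by apply/LinftyP; exists set0, 0; split=> // x _; rewrite normr_le0.
apply/seteqP; split=> [f [B [B0 _ cB] Bf]|f Jf].
  have [oJ cJ] := clopen_ideal_Linfty.
  (* The trace of the clopen set [J] on the connected set [B] contains [0], so it is all of [B]. *)
  suff BJ : B `&` J = B by move: Bf; rewrite -BJ => -[].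
  by apply: cB; [exists 0|exists J|exists J].
have /Umu_scale_continuousP cf := Jf.
(* The line through [0] and [f] is a continuous image of the connected space [R]; it meets these
   points at [r = 0] and [r = 1]. *)
exists ((fun r : R => r *: (f : UmuI mu I)) @` setT).
  split=> //; first by exists 0 => //; rewrite scale0r.
  apply: connected_continuous_connected; last exact: continuous_subspaceT.
  by apply/connected_intervalP.
by exists 1 => //; rewrite scale1r.
Qed.

End Umu_topology.

Theorem theorem3p2 (d : measure_display) (X : measurableType d) (R : realType)
    (mu : {measure set X -> \bar R}) (I : ideal {mfun X >-> R}) :
  (forall f : UmuI mu I,
     continuous (fun r : R => r *: f) <-> (ideal_set I `&` Linfty mu) f) /\
  connected_component [set: UmuI mu I] 0 = ideal_set I `&` Linfty mu.
Proof.
split; first exact: Umu_scale_continuousP.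
exact: connected_component0_UmuI.
Qed.
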